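(* Let $C \subset \mathbb{H}^d$ be a convex body and let $H$ be a supporting hyperplane of $C$ such that $\mathrm{width}_H (C) = \Delta (C)$. Assume that there exists a unique most distant point $j \in C$ from $H$. Then the projection of $j$ onto $H$ belongs to $H \cap C$.
   Context: $\mathbb{H}^d$ is the $d$-dimensional hyperbolic space, and $|ab|$ is the hyperbolic distance of points $a,b$. A set is convex if with every two points it contains the geodesic segment joining them. A convex body in $\mathbb{H}^d$ is a closed bounded convex set with non-empty interior. A hyperplane $H$ supports a convex body $C$ if $H$ has a common point with $C$ and $H$ is disjoint from the interior of $C$. For non-empty sets $A,B$, $\mathrm{dist}(A,B)$ is the infimum of $|ab|$ over $a\in A$, $b\in B$; the distance of a point $c$ from $H$ is $\mathrm{dist}(\{c\},H)$. Projection onto $H$ means orthogonal projection. Two hyperplanes are ultraparallel if they do not intersect in a real or imaginary point (that is, they meet neither in $\mathbb{H}^d$ nor at infinity). For a hyperplane $H$ supporting a convex body $C$, the width $\mathrm{width}_H(C)$ of $C$ determined by $H$ is the distance $\mathrm{dist}(H,J)$ between $H$ and any farthest (from $H$) hyperplane $J$ among those ultraparallel to $H$ and supporting $C$. The thickness $\Delta(C)$ is the infimum of $\mathrm{width}_H(C)$ over all hyperplanes $H$ supporting $C$. *)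

(* Defs.v *)
(* Hyperbolic geometry in the hyperboloid model. *)
From HB Require Import structures.
From mathcomp Require Import all_boot all_order all_algebra.
From mathcomp Require Import all_classical all_reals all_analysis.
Set Implicit Arguments.
Unset Strict Implicit.
Unset Printing Implicit Defensive.
Import Order.TTheory GRing.Theory Num.Theory.
Import numFieldNormedType.Exports.

Local Open Scope classical_set_scope.
Local Open Scope ring_scope.

(* Signature (-, +, ..., +), the 0th coordinate being the time-like one. *)
Definition minkowski (R : realType) (d : nat) (x y : 'rV[R]_d.+1) : R :=
  \sum_(i < d) x ord0 (lift ord0 i) * y ord0 (lift ord0 i)
  - x ord0 ord0 * y ord0 ord0.

Definition hyperboloid (R : realType) (d : nat) : set 'rV[R]_d.+1 :=
  [set x | minkowski x x = -1 /\ 0 < x ord0 ord0].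

(* As a [set_type], it carries the topology induced by R^(d+1), which is also
   the topology of the hyperbolic distance; [closed] and [interior] below refer
   to it. *)
Definition hspace (R : realType) (d : nat) : topologicalType :=
  set_type (@hyperboloid R d).

Definition hvec (R : realType) (d : nat) (a : hspace R d) : 'rV[R]_d.+1 :=
  set_val a.

Definition arcosh (R : realType) (u : R) : R := ln (u + Num.sqrt (u ^+ 2 - 1)).

Definition hdist (R : realType) (d : nat) (a b : hspace R d) : R :=
  arcosh (- minkowski (hvec a) (hvec b)).

Definition dist (R : realType) (d : nat) (A B : set (hspace R d)) : R :=
  inf [set hdist a b | a in A & b in B].

Definition geodesic_path (R : realType) (d : nat) (a b : hspace R d)
    (g : R -> hspace R d) : Prop :=
  [/\ g 0 = a, g (hdist a b) = b &
      forall s t : R, 0 <= s <= hdist a b -> 0 <= t <= hdist a b ->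
        hdist (g s) (g t) = `|s - t|].

Definition geodesic_segment (R : realType) (d : nat) (a b : hspace R d) :
    set (hspace R d) :=
  [set z | exists2 g : R -> hspace R d, geodesic_path a b g &
           exists2 t : R, 0 <= t <= hdist a b & g t = z].

Definition hconvex (R : realType) (d : nat) (C : set (hspace R d)) : Prop :=
  forall a b, C a -> C b -> geodesic_segment a b `<=` C.

Definition hbounded (R : realType) (d : nat) (C : set (hspace R d)) : Prop :=
  exists r : R, forall a b, C a -> C b -> hdist a b <= r.

Definition convex_body (R : realType) (d : nat) (C : set (hspace R d)) : Prop :=
  [/\ closed C, hbounded C, hconvex C & interior C !=set0].

(* A hyperplane is the trace on the hyperboloid of the Minkowski-orthogonal
   complement of a space-like vector, which is determined by the hyperplane up
   to a nonzero factor. *)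
Record hyperplane (R : realType) (d : nat) : Type := Hyperplane {
  normal : 'rV[R]_d.+1;
  normal_spacelike : 0 < minkowski normal normal
}.

Definition hpoints (R : realType) (d : nat) (H : hyperplane R d) :
    set (hspace R d) :=
  [set x | minkowski (hvec x) (normal H) = 0].

(* A point at infinity is a ray of future light-like vectors, represented by
   its unique element with time coordinate 1. *)
Definition ideal_boundary (R : realType) (d : nat) : set 'rV[R]_d.+1 :=
  [set l | minkowski l l = 0 /\ l ord0 ord0 = 1].

Definition ideal_points (R : realType) (d : nat) (H : hyperplane R d) :
    set 'rV[R]_d.+1 :=
  [set l | ideal_boundary l /\ minkowski l (normal H) = 0].

Definition ultraparallel (R : realType) (d : nat) (H J : hyperplane R d) :
    Prop :=
  hpoints H `&` hpoints J = set0 /\ ideal_points H `&` ideal_points J = set0.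

Definition supports (R : realType) (d : nat) (H : hyperplane R d)
    (C : set (hspace R d)) : Prop :=
  hpoints H `&` C !=set0 /\ hpoints H `&` interior C = set0.

Definition ultraparallel_support (R : realType) (d : nat)
    (C : set (hspace R d)) (H J : hyperplane R d) : Prop :=
  ultraparallel H J /\ supports J C.

Definition farthest_ultraparallel_support (R : realType) (d : nat)
    (C : set (hspace R d)) (H J : hyperplane R d) : Prop :=
  ultraparallel_support C H J /\
  forall J', ultraparallel_support C H J' ->
    dist (hpoints H) (hpoints J') <= dist (hpoints H) (hpoints J).

(* [is_width C H w] means that the width of C determined by H is w; w is unique,
   as all farthest J have the same distance from H. *)
Definition is_width (R : realType) (d : nat) (C : set (hspace R d))
    (H : hyperplane R d) (w : R) : Prop :=
  exists2 J, farthest_ultraparallel_support C H J &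
             dist (hpoints H) (hpoints J) = w.

Definition thickness (R : realType) (d : nat) (C : set (hspace R d)) : R :=
  inf [set w | exists2 H, supports H C & is_width C H w].

Definition most_distant (R : realType) (d : nat) (C : set (hspace R d))
    (H : hyperplane R d) (j : hspace R d) : Prop :=
  C j /\ forall x, C x -> dist [set x] (hpoints H) <= dist [set j] (hpoints H).

(* Component of x orthogonal to p, i.e. in the tangent space at p: it is zero if
   x = p, and otherwise it points from p along the geodesic from p to x. *)
Definition direction (R : realType) (d : nat) (p x : hspace R d) :
    'rV[R]_d.+1 :=
  hvec x + minkowski (hvec x) (hvec p) *: hvec p.

(* p is the foot of the perpendicular from x to H: the geodesic from p to x is
   orthogonal to all geodesics from p to points of H (on tangent spaces the
   Riemannian metric is the Minkowski form).  For x in H this forces p = x. *)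
Definition is_projection (R : realType) (d : nat) (H : hyperplane R d)
    (x p : hspace R d) : Prop :=
  hpoints H p /\
  forall q, hpoints H q -> minkowski (direction p x) (direction p q) = 0.

(* Main.v *)
From Pilot Require Import Defs.
From mathcomp Require Import all_boot all_order all_algebra.
From mathcomp Require Import all_classical all_reals all_analysis.
From mathcomp Require Import ring lra.
(* The name [minkowski] is again that of the Lorentzian form, instead of that of
   an inequality between norms. *)
Import Pilot.Defs.
Set Implicit Arguments.
Unset Strict Implicit.
Unset Printing Implicit Defensive.
Import Order.TTheory GRing.Theory Num.Theory.
Import numFieldNormedType.Exports.
Local Open Scope classical_set_scope.
Local Open Scope ring_scope.

(** Let [n] be the unit normal of [H] for which [C] lies in the half-space
    [0 <= ⟨x, n⟩].  The number [⟨x, n⟩] is the hyperbolic sine of the distance of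
    [x] from [H], so the farthest point [j] is the unique maximizer of a linear
    form on [C].

    The width determined by [H] equals the distance of [j] from [H]
    ([is_width_most_distant]): a supporting hyperplane [J] contains a point of
    [C] and therefore is not farther from [H] than [j] is; and this bound is
    attained, because the hyperplane through [j] perpendicular to the
    perpendicular from [j] to [H] is tangent at [j] to the convex equidistant
    region in which [C] lies, hence supports [C].

    Suppose that the foot [p] of that perpendicular is not in [C].  Let [q] be the
    point of the face [F], the intersection of [H] and [C], that is nearest to
    [p], and put [v := q - p], a normal of the perpendicular bisector of [p] and
    [q].  By convexity the angle at [q] between [p] and any other point of [F] is
    not acute ([nearest_obtuse]), so [F] lies on the side of [q]:
    [⟨x, v⟩ > 0] on [F].  On the other hand [⟨j, v⟩ < 0], as [j] is a positive
    multiple of [p] up to the normal [n].  By compactness [n + e v] is, for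
    small [e > 0], positive on [C] and smaller on [C] than [⟨j, n⟩]: it is here
    that the uniqueness of [j] matters.  Adding a suitable multiple of [e p] makes
    the new form vanish somewhere on [C] while only decreasing its values, and
    the resulting normal is not shorter than [n] ([tilt]).  It belongs to a
    supporting hyperplane of [C] that determines a width smaller than that of
    [H], against the assumption that the latter is the thickness.

    Convexity is used through one fact ([hconvex_conic]): if [a] and [b] are in
    [C], then so is every point of the hyperboloid that is a nonnegative
    combination of [a] and [b].  All other computations are linear algebra in
    Minkowski space. *)

Local Notation "⟨ x , y ⟩" := (minkowski x y)
  (at level 0, x at level 99, y at level 99, format "⟨ x ,  y ⟩").
Local Notation time x := (x ord0 ord0).

(** * Minkowski space *)

Section Minkowski.
Variables (R : realType) (d : nat).
Implicit Types (x y z a b n : 'rV[R]_d.+1) (c : R).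

Lemma minkowskiC x y : ⟨x, y⟩ = ⟨y, x⟩.
Proof.
by rewrite /minkowski mulrC; congr (_ - _); apply: eq_bigr => i _; rewrite mulrC.
Qed.

Lemma minkowskiDl x y z : ⟨x + y, z⟩ = ⟨x, z⟩ + ⟨y, z⟩.
Proof.
rewrite /minkowski !mxE.
under eq_bigr do rewrite mxE mulrDl.
by rewrite big_split /=; ring.
Qed.

Lemma minkowskiZl c x y : ⟨c *: x, y⟩ = c * ⟨x, y⟩.
Proof.
rewrite /minkowski !mxE mulrBr mulr_sumr mulrA.
by under eq_bigr do rewrite mxE -mulrA.
Qed.

Lemma minkowskiNl x y : ⟨- x, y⟩ = - ⟨x, y⟩.
Proof. by rewrite -scaleN1r minkowskiZl mulN1r. Qed.

Lemma minkowskiDr x y z : ⟨z, x + y⟩ = ⟨z, x⟩ + ⟨z, y⟩.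
Proof. by rewrite !(minkowskiC z) minkowskiDl. Qed.

Lemma minkowskiZr c x y : ⟨y, c *: x⟩ = c * ⟨y, x⟩.
Proof. by rewrite !(minkowskiC y) minkowskiZl. Qed.

Lemma minkowskiNr x y : ⟨y, - x⟩ = - ⟨y, x⟩.
Proof. by rewrite !(minkowskiC y) minkowskiNl. Qed.

Definition minkowskiE := (minkowskiDl, minkowskiDr, minkowskiNl, minkowskiNr,
  minkowskiZl, minkowskiZr).

Lemma sum_cauchy_schwarz (m : nat) (u v : 'I_m -> R) :
  (\sum_i u i * v i) ^+ 2 <= (\sum_i u i ^+ 2) * (\sum_i v i ^+ 2).
Proof.
set D := \sum_i u i * v i; set A := \sum_i u i ^+ 2; set B := \sum_i v i ^+ 2.
have B0 : 0 <= B by apply: sumr_ge0 => i _; apply: sqr_ge0.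
have quad (s t : R) : 0 <= s ^+ 2 * A - 2 * s * t * D + t ^+ 2 * B.
  have -> : s ^+ 2 * A - 2 * s * t * D + t ^+ 2 * B =
      \sum_i (s * u i - t * v i) ^+ 2.
    rewrite !mulr_sumr -sumrB -big_split /=; apply: eq_bigr => i _; ring.
  by apply: sumr_ge0 => i _; apply: sqr_ge0.
have [B_eq0|B_neq0] := eqVneq B 0.
  suff -> : D = 0 by rewrite B_eq0 expr0n mulr0.
  apply: big1 => i _.
  have /psumr_eq0P v0 : \sum_i v i ^+ 2 = 0 := B_eq0.
  have /eqP := v0 (fun i _ => sqr_ge0 (v i)) i isT.
  by rewrite sqrf_eq0 => /eqP ->; rewrite mulr0.
have Bgt0 : 0 < B by rewrite lt_neqAle eq_sym B_neq0.
have := quad B D.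
have -> : B ^+ 2 * A - 2 * B * D * D + D ^+ 2 * B = B * (A * B - D ^+ 2) by ring.
by rewrite pmulr_rge0 // subr_ge0.
Qed.

Lemma space_sqr_ge0 x : 0 <= ⟨x, x⟩ + time x ^+ 2.
Proof.
rewrite /minkowski expr2 subrK.
by apply: sumr_ge0 => i _; rewrite -expr2 sqr_ge0.
Qed.

Lemma space_cauchy_schwarz x y : (⟨x, y⟩ + time x * time y) ^+ 2 <=
  (⟨x, x⟩ + time x ^+ 2) * (⟨y, y⟩ + time y ^+ 2).
Proof.
rewrite /minkowski subrK !(expr2 (_ ord0 ord0)) !subrK.
have := sum_cauchy_schwarz (fun i => x ord0 (lift ord0 i))
  (fun i => y ord0 (lift ord0 i)).
rewrite /=; under [X in _ <= X * _]eq_bigr do rewrite expr2.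
by under [X in _ <= _ * X]eq_bigr do rewrite expr2.
Qed.

(** Two nonzero causal vectors of the same time orientation, one of them
    time-like, cannot be orthogonal: the space parts are controlled by the time
    parts, so that Cauchy-Schwarz on the space parts fixes the sign. *)
Lemma minkowski_future_lt0 x y :
  ⟨x, x⟩ < 0 -> 0 < time x -> ⟨y, y⟩ <= 0 -> 0 < time y -> ⟨x, y⟩ < 0.
Proof.
move=> xx x0 yy y0; rewrite ltNge; apply/negP => xy.
have := space_cauchy_schwarz x y; have := space_sqr_ge0 x.
move: (time x) (time y) x0 y0 ⟨x, x⟩ ⟨y, y⟩ ⟨x, y⟩ xx yy xy.
move=> s t s0 t0 xx yy xy xx0 yy0 xy0 X0; apply/negP; rewrite -ltNge.
have st0 : 0 < s * t by rewrite mulr_gt0.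
apply: (@le_lt_trans _ _ ((xx + s ^+ 2) * t ^+ 2)).
  by apply: ler_wpM2l => //; lra.
apply: (@lt_le_trans _ _ ((s * t) ^+ 2)).
  by rewrite exprMn ltr_pM2r ?exprn_gt0 //; lra.
by rewrite ler_sqr ?nnegrE; lra.
Qed.

Lemma minkowski_time0 x : time x = 0 -> x = 0 \/ 0 < ⟨x, x⟩.
Proof.
move=> x0; rewrite /minkowski x0 mulr0 subr0.
have sq (i : 'I_d) : 0 <= x ord0 (lift ord0 i) * x ord0 (lift ord0 i).
  by rewrite -expr2 sqr_ge0.
have [sum0|sumN0] := eqVneq (\sum_(i < d)
  x ord0 (lift ord0 i) * x ord0 (lift ord0 i)) 0; [left|right].
  apply/rowP => k; rewrite mxE; case: (unliftP ord0 k) => [i|] -> //.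
  have all0 := psumr_eq0P (fun j _ => sq j) sum0; have /eqP := all0 i isT.
  by rewrite mulf_eq0 orbb => /eqP.
by rewrite lt_neqAle eq_sym sumN0 sumr_ge0 // => i _; rewrite -expr2 sqr_ge0.
Qed.

(** For a suitable sign, a nonzero causal [y] would be future-directed and
    contradict [minkowski_future_lt0]: the form is positive definite on the
    orthogonal complement of a time-like vector. *)
Lemma minkowski_orth_timelike x y :
  ⟨x, x⟩ < 0 -> 0 < time x -> ⟨x, y⟩ = 0 -> y = 0 \/ 0 < ⟨y, y⟩.
Proof.
move=> xx x0 xy; case: (ltP 0 ⟨y, y⟩) => [|yy]; first by right.
case: (ltgtP (time y) 0) => [y0|y0|y0].
- have := @minkowski_future_lt0 x (- y) xx x0.
  rewrite !minkowskiE opprK xy oppr0 mxE oppr_gt0 ltxx => h.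
  by have := h yy y0.
- by have := minkowski_future_lt0 xx x0 yy y0; rewrite xy ltxx.
- by have [->|] := minkowski_time0 y0; [left|rewrite ltNge yy].
Qed.

Lemma timelike_future x y :
  ⟨x, x⟩ < 0 -> 0 < time x -> ⟨y, y⟩ < 0 -> ⟨x, y⟩ < 0 -> 0 < time y.
Proof.
move=> xx x0 yy xy; case: (ltgtP (time y) 0) => // y0.
- have := @minkowski_future_lt0 x (- y) xx x0.
  rewrite !minkowskiE opprK mxE oppr_gt0 => /(_ (ltW yy) y0); lra.
- case: (minkowski_time0 y0) => [y_eq0|]; last lra.
  by move: yy; rewrite y_eq0 -(scale0r y) minkowskiZl mul0r ltxx.
Qed.

Lemma hyperboloid_norm x : hyperboloid x -> ⟨x, x⟩ = -1.
Proof. by case. Qed.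

Lemma hyperboloid_timelike x : hyperboloid x -> ⟨x, x⟩ < 0.
Proof. by case=> -> _; rewrite ltrN10. Qed.

Lemma hyperboloid_time x : hyperboloid x -> 0 < time x.
Proof. by case. Qed.

Lemma hyperboloidP x y :
  hyperboloid x -> ⟨y, y⟩ = -1 -> ⟨x, y⟩ < 0 -> hyperboloid y.
Proof.
move=> hx yy xy; split => //.
apply: (timelike_future (hyperboloid_timelike hx) (hyperboloid_time hx)) => //.
by rewrite yy ltrN10.
Qed.

Lemma hyperboloid_causal_lt0 x y :
  hyperboloid x -> ⟨y, y⟩ <= 0 -> 0 < time y -> ⟨x, y⟩ < 0.
Proof. by case=> xx x0; apply: minkowski_future_lt0; rewrite ?xx ?ltrN10. Qed.

Lemma hyperboloid_orth x y : hyperboloid x -> ⟨x, y⟩ = 0 -> 0 <= ⟨y, y⟩.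
Proof.
case=> xx x0 xy.
have [|->|/ltW //] := @minkowski_orth_timelike x y _ x0 xy; first by rewrite xx ltrN10.
by rewrite -(scale0r x) minkowskiZl mul0r.
Qed.

Lemma hyperboloid_lt0 x y : hyperboloid x -> hyperboloid y -> ⟨x, y⟩ < 0.
Proof.
by move=> hx [yy y0]; apply: hyperboloid_causal_lt0 => //; rewrite yy lerN10.
Qed.

(** This holds because the component of [y] orthogonal to [x] is not
    time-like. *)
Lemma hyperboloid_leN1 x y : hyperboloid x -> hyperboloid y -> ⟨x, y⟩ <= -1.
Proof.
move=> hx hy; have xy := hyperboloid_lt0 hx hy.
have xx := hyperboloid_norm hx; have yy := hyperboloid_norm hy.
have := @hyperboloid_orth x (y + ⟨x, y⟩ *: x) hx.
rewrite !minkowskiE (minkowskiC y x) xx yy; nra.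
Qed.

Lemma hyperboloid_eq x y :
  hyperboloid x -> hyperboloid y -> ⟨x, y⟩ = -1 -> x = y.
Proof.
move=> hx hy xy.
have xx := hyperboloid_norm hx; have yy := hyperboloid_norm hy.
have := @minkowski_orth_timelike x (x - y) (hyperboloid_timelike hx)
  (hyperboloid_time hx).
rewrite !minkowskiE (minkowskiC y x) xx yy xy => h.
have [|/eqP|h_gt0] := h; first lra.
  by rewrite subr_eq0 => /eqP.
exfalso; lra.
Qed.

Definition unitize y : 'rV[R]_d.+1 := (Num.sqrt (- ⟨y, y⟩))^-1 *: y.

Lemma unitize_hyperboloid y : ⟨y, y⟩ < 0 -> 0 < time y -> hyperboloid (unitize y).
Proof.
move=> yy y0; have s0 : 0 < Num.sqrt (- ⟨y, y⟩) by rewrite sqrtr_gt0 oppr_gt0.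
split; last by rewrite mxE mulr_gt0 // invr_gt0.
have s2 : Num.sqrt (- ⟨y, y⟩) ^+ 2 = - ⟨y, y⟩ by rewrite sqr_sqrtr // oppr_ge0 ltW.
rewrite !minkowskiE; apply: (@mulIf _ (Num.sqrt (- ⟨y, y⟩) ^+ 2)).
  by rewrite expf_neq0 // gt_eqF.
rewrite {2}s2; field; by rewrite gt_eqF.
Qed.

(** [perp_cosh n x] and [⟨x, n⟩] are the hyperbolic cosine and sine of the
    signed distance of [x] from the hyperplane with unit normal [n], and
    [foot n x] is the foot of the perpendicular. *)
Definition perp_cosh n x : R := Num.sqrt (1 + ⟨x, n⟩ ^+ 2).
Definition foot n x : 'rV[R]_d.+1 := (perp_cosh n x)^-1 *: (x - ⟨x, n⟩ *: n).

Lemma perp_cosh_sqr n x : perp_cosh n x ^+ 2 = 1 + ⟨x, n⟩ ^+ 2.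
Proof. by rewrite sqr_sqrtr // addr_ge0 // sqr_ge0. Qed.

Lemma perp_cosh_ge1 n x : 1 <= perp_cosh n x.
Proof. by rewrite -{1}(sqrtr1 R) ler_sqrt ?lerDl ?sqr_ge0 // addr_ge0 // sqr_ge0. Qed.

Lemma perp_cosh_gt0 n x : 0 < perp_cosh n x.
Proof. exact: lt_le_trans ltr01 (perp_cosh_ge1 n x). Qed.

Lemma foot_decomp n x : x = perp_cosh n x *: foot n x + ⟨x, n⟩ *: n.
Proof. by rewrite scalerA divff ?scale1r ?subrK // gt_eqF // perp_cosh_gt0. Qed.

Lemma foot_orth n x : ⟨n, n⟩ = 1 -> ⟨foot n x, n⟩ = 0.
Proof. by move=> nn; rewrite !minkowskiE nn; ring. Qed.

Lemma foot_hyperboloid n x : ⟨n, n⟩ = 1 -> hyperboloid x -> hyperboloid (foot n x).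
Proof.
move=> nn hx; have c0 := perp_cosh_gt0 n x; have c2 := perp_cosh_sqr n x.
have xx := hyperboloid_norm hx.
have E : perp_cosh n x * ⟨x, foot n x⟩ = - (1 + ⟨x, n⟩ ^+ 2).
  rewrite !minkowskiE xx; field; exact: lt0r_neq0.
apply: (hyperboloidP hx).
  rewrite !minkowskiE xx nn (minkowskiC n x).
  apply: (@mulIf _ (perp_cosh n x ^+ 2)); first exact/expf_neq0/lt0r_neq0.
  rewrite {2}c2; field; exact: lt0r_neq0.
by rewrite -(pmulr_rlt0 _ c0) E oppr_lt0 ltr_pwDl // sqr_ge0.
Qed.

(** Hyperbolic Pythagoras: for [a] on the hyperplane, [⟨a, x⟩] is
    [perp_cosh n x] times [⟨a, foot n x⟩]. *)
Lemma perp_cosh_le n x a :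
  ⟨n, n⟩ = 1 -> hyperboloid x -> hyperboloid a -> ⟨a, n⟩ = 0 ->
  perp_cosh n x <= - ⟨a, x⟩.
Proof.
move=> nn hx ha an; have := hyperboloid_leN1 ha (foot_hyperboloid nn hx).
have -> : ⟨a, x⟩ = perp_cosh n x * ⟨a, foot n x⟩.
  by rewrite {1}(foot_decomp n x) !minkowskiDr !minkowskiZr an mulr0 addr0.
have := perp_cosh_gt0 n x; nra.
Qed.

Lemma minkowski_foot n x : ⟨n, n⟩ = 1 -> hyperboloid x ->
  ⟨foot n x, x⟩ = - perp_cosh n x.
Proof.
move=> nn hx; have := foot_hyperboloid nn hx; have := foot_orth x nn.
have := foot_decomp n x; move: (foot n x) => f xE fn [ff _].
have -> : ⟨f, x⟩ = ⟨f, perp_cosh n x *: f + ⟨x, n⟩ *: n⟩ by rewrite -xE.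
by rewrite !minkowskiE ff fn mulr0 addr0 mulrN1.
Qed.

End Minkowski.

(** * The hyperbolic metric *)

Section Arcosh.
Variable R : realType.
Implicit Types s t u v : R.

Definition cosh t : R := (expR t + expR (- t)) / 2.
Definition sinh t : R := (expR t - expR (- t)) / 2.

Lemma cosh_sqr t : cosh t ^+ 2 = 1 + sinh t ^+ 2.
Proof.
have := expRxMexpNx_1 t; rewrite /cosh /sinh.
move: (expR t) (expR (- t)) => p q pq.
have -> : ((p + q) / 2) ^+ 2 = p * q + ((p - q) / 2) ^+ 2 by field.
by rewrite pq.
Qed.

Lemma cosh_gt0 t : 0 < cosh t.
Proof. by rewrite divr_gt0 // addr_gt0 // expR_gt0. Qed.

Lemma sinh_ge0 t : (0 <= sinh t) = (0 <= t).
Proof. by rewrite pmulr_lge0 ?invr_gt0 // subr_ge0 ler_expR; lra. Qed.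

Lemma coshB s t : cosh (s - t) = cosh s * cosh t - sinh s * sinh t.
Proof. by rewrite /cosh /sinh opprB !expRD; field. Qed.

Lemma sinhB s t : sinh (s - t) = sinh s * cosh t - cosh s * sinh t.
Proof. by rewrite /cosh /sinh opprB !expRD; field. Qed.

Lemma arcosh_cosh t : arcosh (cosh t) = `|t|.
Proof.
have tN : `|t| = t \/ `|t| = - t by case: (ger0P t); [left|right].
have -> : cosh t = cosh `|t| by case: tN => ->; rewrite /cosh ?opprK // addrC.
rewrite /arcosh cosh_sqr [1 + _]addrC addrK sqrtr_sqr (@ger0_norm _ (sinh _)) ?sinh_ge0 //.
rewrite -[RHS]expRK; congr ln; rewrite /cosh /sinh; by field.
Qed.

Lemma arcosh_arg_ge1 u : 1 <= u -> 1 <= u + Num.sqrt (u ^+ 2 - 1).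
Proof. by move=> u1; rewrite ler_wpDr ?sqrtr_ge0. Qed.

Lemma arcosh_ge0 u : 1 <= u -> 0 <= arcosh u.
Proof. by move=> u1; rewrite ln_ge0 // arcosh_arg_ge1. Qed.

Lemma arcoshK u : 1 <= u -> cosh (arcosh u) = u.
Proof.
move=> u1; have e1 := arcosh_arg_ge1 u1.
have e0 := lt_le_trans ltr01 e1.
rewrite /cosh expRN /arcosh lnK ?posrE //.
have s2 : Num.sqrt (u ^+ 2 - 1) ^+ 2 = u ^+ 2 - 1 by rewrite sqr_sqrtr //; nra.
move: e0 s2; move: (Num.sqrt _) => s e0 s2.
have -> : (u + s)^-1 = u - s.
  apply: (@mulfI _ (u + s)); first exact: lt0r_neq0.
  by rewrite divff ?lt0r_neq0 // mulrC -subr_sqr s2 subKr.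
by field.
Qed.

Lemma le_cosh s t : 0 <= s -> s <= t -> cosh s <= cosh t.
Proof.
move=> s0 st; rewrite ler_pM2r ?invr_gt0 // !expRN.
have p1 : 1 <= expR s by rewrite -expR0 ler_expR.
have pq : expR s <= expR t by rewrite ler_expR.
move: (expR s) (expR t) p1 pq => p q p1 pq.
have p0 : 0 < p by lra.
have q0 : 0 < q by lra.
rewrite -subr_ge0.
have -> : q + q^-1 - (p + p^-1) = (q - p) * (p * q - 1) / (p * q).
  by field; rewrite !lt0r_neq0.
by rewrite divr_ge0 ?mulr_ge0 //; nra.
Qed.

Lemma ler_arcosh u v : 1 <= u -> 1 <= v -> (arcosh u <= arcosh v) = (u <= v).
Proof.
move=> u1 v1; apply/idP/idP => [|uv].
  by move=> /le_cosh -/(_ (arcosh_ge0 u1)); rewrite !arcoshK.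
rewrite ler_ln ?posrE ?(lt_le_trans ltr01) ?arcosh_arg_ge1 //.
by rewrite lerD // ler_wsqrtr // lerB // lerXn2r ?nnegrE //; lra.
Qed.

Lemma ltr_arcosh u v : 1 <= u -> 1 <= v -> (arcosh u < arcosh v) = (u < v).
Proof. by move=> u1 v1; rewrite !ltNge ler_arcosh. Qed.

End Arcosh.

Section HyperbolicSpace.
Variables (R : realType) (d : nat).
Implicit Types (a b x y : hspace R d) (u v n : 'rV[R]_d.+1) (C : set (hspace R d)).

Lemma hvecP a : hyperboloid (hvec a).
Proof. exact: set_valP. Qed.

Lemma hvec_inj : injective (@hvec R d).
Proof. exact: val_inj. Qed.

Definition point_of v (hv : hyperboloid v) : hspace R d := exist _ v (mem_set hv).

Lemma hvec_point_of v (hv : hyperboloid v) : hvec (point_of hv) = v.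
Proof. by []. Qed.

Lemma hvec_ge1 a b : 1 <= - ⟨hvec a, hvec b⟩.
Proof. by rewrite lerNr; apply: hyperboloid_leN1; exact: hvecP. Qed.

Lemma hdist_ge0 a b : 0 <= hdist a b.
Proof. exact/arcosh_ge0/hvec_ge1. Qed.

Lemma geodesic_curve_hyperboloid a u s :
  ⟨u, u⟩ = 1 -> ⟨hvec a, u⟩ = 0 -> hyperboloid (cosh s *: hvec a + sinh s *: u).
Proof.
move=> uu au; have aa := hyperboloid_norm (hvecP a).
apply: (hyperboloidP (hvecP a)); rewrite !minkowskiE ?(minkowskiC u) ?uu au aa.
  by have := cosh_sqr s; nra.
by have := cosh_gt0 s; nra.
Qed.

(** Geodesics are the central projections of chords, so that convexity in terms of
    geodesics amounts to convexity of the cone over the set. *)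
Lemma hconvex_conic C a b x (s t : R) : hconvex C -> C a -> C b ->
  0 <= s -> 0 <= t -> hvec x = s *: hvec a + t *: hvec b -> C x.
Proof.
move=> Cconv Ca Cb s0 t0 xE.
have aa := hyperboloid_norm (hvecP a); have bb := hyperboloid_norm (hvecP b).
have xx := hyperboloid_norm (hvecP x).
have [ab|ab] := eqVneq a b.
  suff -> : x = a by [].
  have {}xE : hvec x = (s + t) *: hvec a by rewrite xE -ab -scalerDl.
  apply: hvec_inj; rewrite xE -[RHS]scale1r; congr (_ *: _).
  by move: xx; rewrite xE !minkowskiE aa; nra.
set L := hdist a b; have L0 : 0 <= L := hdist_ge0 a b.
have abL : ⟨hvec a, hvec b⟩ = - cosh L by rewrite arcoshK ?hvec_ge1 // opprK.
have shL : 0 < sinh L.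
  rewrite lt_neqAle sinh_ge0 L0 andbT eq_sym; apply: contra_neq ab => sh0.
  apply: hvec_inj; apply: hyperboloid_eq; [exact: hvecP|exact: hvecP|].
  have := cosh_gt0 L; have := cosh_sqr L; rewrite sh0 abL; nra.
pose u := (sinh L)^-1 *: (hvec b - cosh L *: hvec a).
have bE : hvec b = cosh L *: hvec a + sinh L *: u.
  by rewrite scalerA divff ?lt0r_neq0 // scale1r addrC subrK.
have au : ⟨hvec a, u⟩ = 0 by rewrite !minkowskiE aa abL; ring.
clearbody u.
have uu : ⟨u, u⟩ = 1.
  move: bb; rewrite bE !minkowskiE (minkowskiC u) au aa; have := cosh_sqr L.
  move: (cosh L) (sinh L) shL => c h h0 ch hh.
  apply: (@mulfI _ (h ^+ 2)); first exact/expf_neq0/lt0r_neq0.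
  by rewrite mulr1; lra.
pose g r : hspace R d := point_of (geodesic_curve_hyperboloid r uu au).
have gE r : hvec (g r) = cosh r *: hvec a + sinh r *: u by [].
have gd r r' : hdist (g r) (g r') = `|r - r'|.
  rewrite /hdist !gE -arcosh_cosh coshB; congr arcosh.
  by rewrite !minkowskiE (minkowskiC u) au aa uu; ring.
have g0 : g 0 = a.
  apply: hvec_inj; rewrite gE /cosh /sinh oppr0 expR0 subrr mul0r scale0r addr0.
  by rewrite (_ : (1 + 1) / 2 = 1) ?scale1r //; field.
have gL : g L = b by apply: hvec_inj; rewrite gE bE.
pose A := s + t * cosh L; pose B := t * sinh L.
have xE' : hvec x = A *: hvec a + B *: u.
  by rewrite xE bE scalerDr !scalerA addrA -scalerDl.
have AB : A ^+ 2 = 1 + B ^+ 2.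
  by move: xx; rewrite xE' !minkowskiE (minkowskiC u) au aa uu; nra.
have A0 : 0 <= A by rewrite addr_ge0 // mulr_ge0 // ltW // cosh_gt0.
have B0 : 0 <= B by rewrite mulr_ge0 // ltW.
have A1 : 1 <= A by nra.
(* the parameter of [x] on the geodesic *)
pose r := arcosh A.
have chr : cosh r = A by exact: arcoshK.
have r0 : 0 <= r by exact: arcosh_ge0.
have shr : sinh r = B.
  have := cosh_sqr r; rewrite chr AB => /addrI /eqP.
  by rewrite eqf_sqr => /orP[] /eqP // h; have := r0; rewrite -sinh_ge0; nra.
have rL : r <= L.
  rewrite -subr_ge0 -sinh_ge0 sinhB chr shr /A /B.
  have -> : sinh L * (s + t * cosh L) - cosh L * (t * sinh L) = s * sinh L by ring.
  by rewrite mulr_ge0 // ltW.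
apply: (Cconv a b Ca Cb); exists g; first by split.
by exists r; [rewrite r0|apply: hvec_inj; rewrite gE chr shr].
Qed.

End HyperbolicSpace.

(** * Hyperplanes and distances *)

Section Hyperplanes.
Variables (R : realType) (d : nat).
Implicit Types (a b x y : hspace R d) (m n : 'rV[R]_d.+1).
Implicit Types (A B : set (hspace R d)) (H J : hyperplane R d).

(** The multiple is recorded, rather than the equality of the two hyperplanes as
    sets of points, because it also governs the points at infinity. *)
Definition unit_normal H n :=
  ⟨n, n⟩ = 1 /\ exists2 c : R, c != 0 & normal H = c *: n.

Lemma unit_normal_hpoints H n x :
  unit_normal H n -> hpoints H x <-> ⟨hvec x, n⟩ = 0.
Proof.
move=> [_ [c c0 HE]]; rewrite /hpoints /= HE minkowskiZr.
split=> [/eqP|->]; last by rewrite mulr0.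
by rewrite mulf_eq0 (negbTE c0) => /eqP.
Qed.

Lemma unit_normal_exists H :
  unit_normal H ((Num.sqrt ⟨normal H, normal H⟩)^-1 *: normal H).
Proof.
have s0 := normal_spacelike H; set s := Num.sqrt _.
have s_gt0 : 0 < s by rewrite sqrtr_gt0.
have s2 : s ^+ 2 = ⟨normal H, normal H⟩ by rewrite sqr_sqrtr // ltW.
split; last first.
  by exists s; rewrite ?lt0r_neq0 // scalerA divff ?scale1r // lt0r_neq0.
by rewrite !minkowskiE -s2; field; exact: lt0r_neq0.
Qed.

Lemma unit_normalN H n : unit_normal H n -> unit_normal H (- n).
Proof.
move=> [nn [c c0 HE]]; split; first by rewrite !minkowskiE opprK.
by exists (- c); rewrite ?oppr_eq0 // scaleNr scalerN opprK.
Qed.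

Lemma unit_normal_foot H n x (nn : ⟨n, n⟩ = 1) :
  unit_normal H n -> hpoints H (point_of (foot_hyperboloid nn (hvecP x))).
Proof. by move=> Hn; apply/(unit_normal_hpoints _ Hn); exact: foot_orth. Qed.

Lemma hdist_foot n x (nn : ⟨n, n⟩ = 1) :
  hdist (point_of (foot_hyperboloid nn (hvecP x))) x =
  arcosh (perp_cosh n (hvec x)).
Proof.
by rewrite /hdist hvec_point_of minkowski_foot ?opprK //; exact: hvecP.
Qed.

Lemma hdistC a b : hdist a b = hdist b a.
Proof. by rewrite /hdist minkowskiC. Qed.

Lemma dist_le_hdist A B a b : A a -> B b -> dist A B <= hdist a b.
Proof.
move=> Aa Bb; apply: ge_inf; last by exists a => //; exists b.
by exists 0 => _ [a' _ [b' _ <-]]; exact: hdist_ge0.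
Qed.

Lemma le_dist A B (r : R) : A !=set0 -> B !=set0 ->
  (forall a b, A a -> B b -> r <= hdist a b) -> r <= dist A B.
Proof.
move=> [a Aa] [b Bb] le_r; apply: lb_le_inf.
  by exists (hdist a b); exists a => //; exists b.
by move=> _ [a' Aa' [b' Bb' <-]]; exact: le_r.
Qed.

Lemma dist_ge0 A B : 0 <= dist A B.
Proof.
rewrite /dist; have [->|/set0P E0] := eqVneq [set hdist a b | a in A & b in B] set0.
  by rewrite inf0.
by apply: lb_le_inf => // _ [a _ [b _ <-]]; exact: hdist_ge0.
Qed.

Lemma dist_hpoints H n x :
  unit_normal H n -> dist [set x] (hpoints H) = arcosh (perp_cosh n (hvec x)).
Proof.
move=> Hn; have nn := Hn.1; have Hf := unit_normal_foot x nn Hn.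
apply/eqP; rewrite eq_le; apply/andP; split.
  by rewrite -(hdist_foot x nn) hdistC; apply: dist_le_hdist.
apply: le_dist; [by exists x|by exists (point_of (foot_hyperboloid nn (hvecP x)))|].
move=> _ b -> Hb; rewrite ler_arcosh ?perp_cosh_ge1 ?hvec_ge1 //.
rewrite minkowskiC perp_cosh_le //; try exact: hvecP.
exact/(unit_normal_hpoints _ Hn).
Qed.

Lemma ler_dist_hpoints H n x y : unit_normal H n ->
  (dist [set x] (hpoints H) <= dist [set y] (hpoints H)) =
  (`|⟨hvec x, n⟩| <= `|⟨hvec y, n⟩|).
Proof.
move=> Hn; rewrite !(dist_hpoints _ Hn) ler_arcosh ?perp_cosh_ge1 //.
rewrite ler_sqrt ?addr_ge0 ?sqr_ge0 // lerD2l.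
by rewrite -(real_normK (num_real ⟨hvec x, n⟩)) -(real_normK (num_real ⟨hvec y, n⟩))
  ler_sqr ?nnegrE.
Qed.

(** The unit normal of the hyperplane through [x] that is perpendicular to the
    perpendicular dropped from [x] to the hyperplane with unit normal [n]: the
    velocity at [x] of the geodesic that starts at the foot in direction [n]. *)
Definition top_normal n (v : 'rV[R]_d.+1) : 'rV[R]_d.+1 :=
  ⟨v, n⟩ *: foot n v + perp_cosh n v *: n.

Section TopNormal.
Variables (n : 'rV[R]_d.+1) (x : hspace R d).
Hypothesis nn : ⟨n, n⟩ = 1.
Local Notation v := (hvec x).
Local Notation f := (foot n v).
Let hf : hyperboloid (foot n v) := foot_hyperboloid nn (hvecP x).

Lemma top_normalE y :
  ⟨hvec y, top_normal n v⟩ = ⟨v, n⟩ * ⟨f, hvec y⟩ + perp_cosh n v * ⟨hvec y, n⟩.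
Proof.
rewrite /top_normal (minkowskiC f); move: f => g.
by rewrite minkowskiDr !minkowskiZr.
Qed.

Lemma top_normal_unit : ⟨top_normal n v, top_normal n v⟩ = 1.
Proof.
have fn : ⟨f, n⟩ = 0 := foot_orth v nn; have ff := hyperboloid_norm hf.
have := perp_cosh_sqr n v; rewrite /top_normal.
move: f fn ff => g gn gg; rewrite !(minkowskiDl, minkowskiDr).
by rewrite !(minkowskiZl, minkowskiZr) (minkowskiC n) gn gg nn; nra.
Qed.

Lemma top_normal_self : ⟨v, top_normal n v⟩ = 0.
Proof.
by rewrite top_normalE minkowski_foot //; [ring|exact: hvecP].
Qed.

(** The equidistant region of a half-space is convex, and the hyperplane is
    tangent to it. *)
Lemma top_normal_le0 y :
  0 <= ⟨hvec y, n⟩ -> ⟨hvec y, n⟩ <= ⟨v, n⟩ -> ⟨hvec y, top_normal n v⟩ <= 0.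
Proof.
move=> y0 yx; rewrite top_normalE.
have := perp_cosh_le nn (hvecP y) hf (foot_orth _ nn).
have := perp_cosh_sqr n (hvec y); have := perp_cosh_sqr n v.
have := perp_cosh_gt0 n (hvec y); have := perp_cosh_gt0 n v.
move: (perp_cosh n v) (perp_cosh n (hvec y)) ⟨f, hvec y⟩ => c c' g c0 c'0 ce c'e gle.
have x0 : 0 <= ⟨v, n⟩ by lra.
have gx : ⟨v, n⟩ * c' <= ⟨v, n⟩ * - g by exact: ler_wpM2l.
suff : c * ⟨hvec y, n⟩ <= ⟨v, n⟩ * c' by lra.
have h : (c * ⟨hvec y, n⟩) ^+ 2 <= (⟨v, n⟩ * c') ^+ 2.
  rewrite !exprMn ce c'e.
  have : ⟨hvec y, n⟩ ^+ 2 <= ⟨v, n⟩ ^+ 2 by rewrite ler_sqr.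
  by nra.
by rewrite -ler_sqr ?nnegrE // mulr_ge0 // ltW.
Qed.

(** The tangent hyperplane lies entirely beyond the equidistant surface. *)
Lemma top_normal_far y :
  0 <= ⟨v, n⟩ -> ⟨hvec y, top_normal n v⟩ = 0 -> ⟨v, n⟩ <= ⟨hvec y, n⟩.
Proof.
move=> x0; rewrite top_normalE.
have := perp_cosh_le nn (hvecP y) hf (foot_orth _ nn).
have := perp_cosh_sqr n (hvec y); have := perp_cosh_sqr n v.
have := perp_cosh_gt0 n (hvec y); have := perp_cosh_gt0 n v.
move: (perp_cosh n v) (perp_cosh n (hvec y)) ⟨f, hvec y⟩ => c c' g c0 c'0 ce c'e gle.
have gx : ⟨v, n⟩ * c' <= ⟨v, n⟩ * - g by exact: ler_wpM2l.
move=> E; have h : ⟨v, n⟩ * c' <= c * ⟨hvec y, n⟩ by lra.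
have y0 : 0 <= ⟨hvec y, n⟩.
  by rewrite -(pmulr_rge0 _ c0) (le_trans _ h) // mulr_ge0 // ltW.
have : (⟨v, n⟩ * c') ^+ 2 <= (c * ⟨hvec y, n⟩) ^+ 2.
  by rewrite ler_sqr ?nnegrE // mulr_ge0 // ltW.
rewrite !exprMn ce c'e => h2.
by rewrite -ler_sqr ?nnegrE //; lra.
Qed.

End TopNormal.

End Hyperplanes.

(** * Topology of the hyperboloid *)

Section Topology.
Variables (R : realType) (d : nat).
Implicit Types (a b x y : hspace R d) (u v n : 'rV[R]_d.+1).
Implicit Types C : set (hspace R d).

Lemma cvg_minkowski (T : Type) (F : set_system T) {FF : Filter F}
    (f g : T -> 'rV[R]_d.+1) u v :
  f @ F --> u -> g @ F --> v -> ⟨f t, g t⟩ @[t --> F] --> ⟨u, v⟩.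
Proof.
move=> fu gv.
have cf i : f t ord0 i @[t --> F] --> u ord0 i.
  exact: (cvg_comp _ _ fu (@coord_continuous R 1 d.+1 ord0 i u)).
have cg i : g t ord0 i @[t --> F] --> v ord0 i.
  exact: (cvg_comp _ _ gv (@coord_continuous R 1 d.+1 ord0 i v)).
rewrite /minkowski; apply: cvgB; last exact: cvgM.
apply: cvg_big => [|i _]; first exact: add_continuous.
exact: cvgM.
Qed.

Lemma minkowski_sqr_continuous : continuous (fun v : 'rV[R]_d.+1 => ⟨v, v⟩).
Proof. by move=> v; apply: (@cvg_minkowski _ (nbhs v) _ id id); exact: cvg_id. Qed.

Lemma cvg_unitize (T : Type) (F : set_system T) {FF : Filter F}
    (f : T -> 'rV[R]_d.+1) u :
  ⟨u, u⟩ < 0 -> f @ F --> u -> unitize (f t) @[t --> F] --> unitize u.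
Proof.
move=> uu fu; rewrite /unitize; apply: cvgZ => //.
apply: cvgV; first by rewrite lt0r_neq0 // sqrtr_gt0 oppr_gt0.
have cN : - ⟨f t, f t⟩ @[t --> F] --> - ⟨u, u⟩.
  exact: (cvgN (cvg_minkowski fu fu)).
exact: (cvg_comp _ _ cN (@sqrt_continuous R (- ⟨u, u⟩))).
Qed.

Lemma near_future (T : Type) (F : set_system T) {FF : Filter F}
    (f : T -> 'rV[R]_d.+1) u :
  ⟨u, u⟩ < 0 -> 0 < time u -> f @ F --> u ->
  \forall t \near F, ⟨f t, f t⟩ < 0 /\ 0 < time (f t).
Proof.
move=> uu u0 fu; have ff : ⟨f t, f t⟩ @[t --> F] --> ⟨u, u⟩ by exact: cvg_minkowski.
have f0 : f t ord0 ord0 @[t --> F] --> time u.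
  exact: (cvg_comp _ _ fu (@coord_continuous R 1 d.+1 ord0 ord0 u)).
have fneg : \forall t \near F, ⟨f t, f t⟩ < 0 by exact: (cvgr_lt _ ff).
have fpos : \forall t \near F, 0 < time (f t) by exact: (cvgr_gt _ f0).
by near=> t; split; near: t.
Unshelve. all: by end_near. Qed.

Lemma hvec_continuous : continuous (@hvec R d).
Proof. exact: initial_continuous. Qed.

Lemma interior_near C x :
  C^° x <-> \forall v \near hvec x, forall y, hvec y = v -> C y.
Proof.
split=> [|nearC].
  rewrite /interior nbhsE => -[_ [[U oU <-] Ux] sub].
  apply: filterS (open_nbhs_nbhs (conj oU Ux)) => v Uv y yv.
  by apply: sub; rewrite /preimage /= -/(hvec y) yv.
apply: (@filterS _ (nbhs x) _
  (@hvec R d @^-1` [set v | forall y, hvec y = v -> C y])).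
  by move=> y; exact.
exact: hvec_continuous nearC.
Qed.

(** The form in which interior points are used: a curve of time-like vectors
    whose central projection passes through an interior point of [C] is
    projected into [C] near that point. *)
Lemma near_unitize_interior C x (T : Type) (F : set_system T) {FF : Filter F}
    (f : T -> 'rV[R]_d.+1) u :
  ⟨u, u⟩ < 0 -> 0 < time u -> unitize u = hvec x -> C^° x -> f @ F --> u ->
  \forall t \near F, exists y, [/\ C y, hvec y = unitize (f t) & ⟨f t, f t⟩ < 0].
Proof.
move=> uu u0 ux /interior_near Cx fu; rewrite -ux in Cx.
have unear : \forall t \near F, forall y, hvec y = unitize (f t) -> C y.
  exact: (cvg_unitize uu fu Cx).
have fnear : \forall t \near F, ⟨f t, f t⟩ < 0 /\ 0 < time (f t).
  exact: (near_future uu u0 fu).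
near=> t.
have Ct : forall y, hvec y = unitize (f t) -> C y by near: t.
have [ft ft0] : ⟨f t, f t⟩ < 0 /\ 0 < time (f t) by near: t.
exists (point_of (unitize_hyperboloid ft ft0)); split => //.
exact: Ct.
Unshelve. all: by end_near. Qed.

Lemma unitize_hvec x : unitize (hvec x) = hvec x.
Proof.
by rewrite /unitize (hyperboloid_norm (hvecP x)) opprK sqrtr1 invr1 scale1r.
Qed.

(** Sets that are bounded for the hyperbolic distance have bounded coordinates;
    the time coordinate [time v] is controlled by the distance of [v] from any
    fixed point [u]. *)
Lemma hyperboloid_time_le u v : hyperboloid u -> hyperboloid v ->
  time v <= 2 * time u * - ⟨u, v⟩.
Proof.
move=> [uu u0] [vv v0].
have := space_cauchy_schwarz u v; have := space_sqr_ge0 u; rewrite uu vv.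
move: (time u) (time v) u0 v0 ⟨u, v⟩ => s t s0 t0 g s1 cs.
rewrite -(ler_pM2l t0); have := sqr_ge0 g; lra.
Qed.

Lemma hyperboloid_coord_le v i : hyperboloid v -> `|v ord0 i| <= time v.
Proof.
move=> [vv v0]; case: (unliftP ord0 i) => [k|] ->; last by rewrite gtr0_norm.
rewrite -[leRHS]gtr0_norm // -ler_sqr ?nnegrE // !real_normK ?num_real //.
rewrite !expr2; move: vv; rewrite /minkowski (bigD1 k) //=.
have : 0 <= \sum_(j < d | j != k) v ord0 (lift ord0 j) * v ord0 (lift ord0 j).
  by apply: sumr_ge0 => j _; rewrite -expr2 sqr_ge0.
lra.
Qed.

Lemma hyperboloid_closed : closed (@hyperboloid R d).
Proof.
have -> : @hyperboloid R d =
    (fun v => ⟨v, v⟩) @^-1` [set r | r = -1] `&`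
    (fun v => v ord0 ord0) @^-1` [set r | 0 <= r].
  apply/seteqP; split=> v /= [vv v0]; first by split; [|exact: ltW].
  split=> //; rewrite lt_neqAle v0 andbT eq_sym; apply/eqP => /minkowski_time0.
  by case=> [v_eq0|]; [move: vv; rewrite v_eq0 -(scale0r v) minkowskiZl|]; lra.
apply: closedI; apply: preimage_closed.
- by move=> v _; exact: minkowski_sqr_continuous.
- exact: closed_eq.
- by move=> v _; exact: coord_continuous.
- exact: closed_ge.
Qed.

Lemma hbounded_closed_compact C : closed C -> hbounded C -> compact C.
Proof.
move=> clC [r Cr]; have [->|/set0P[a Ca]] := eqVneq C set0; first exact: compact0.
have clV : closed (@hvec R d @` C).
  move: clC; rewrite -openC => -[U oU UC].
  have -> : @hvec R d @` C = @hyperboloid R d `&` ~` U.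
    apply/seteqP; split=> [_ [x Cx <-]|v [hv Uv]].
      split; first exact: hvecP.
      by move=> Ux; have : (~` C) x by rewrite -UC.
    exists (point_of hv) => //; apply: contrapT => nC.
    by apply: Uv; move: nC; rewrite -[~ _]/((~` C) _) -UC.
  by apply: closedI; [exact: hyperboloid_closed|exact: open_closedC].
pose M := 2 * time (hvec a) * cosh r.
have cV : compact (@hvec R d @` C).
  pose box := [set v : 'rV[R]_d.+1 | forall i, `[- M, M]%classic (v ord0 i)].
  have cbox : compact box.
    by apply: (@rV_compact R d.+1 (fun=> `[- M, M]%classic)) => i; exact: segment_compact.
  apply: (subclosed_compact clV cbox) => _ [x Cx <-] i /=.
  rewrite in_itv /= -ler_norml (le_trans (hyperboloid_coord_le _ (hvecP x))) //.
  rewrite (le_trans (hyperboloid_time_le (hvecP a) (hvecP x))) //.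
  rewrite ler_pM2l ?mulr_gt0 ?(hyperboloid_time (hvecP a)) //.
  by rewrite -[leLHS](arcoshK (hvec_ge1 a x)) le_cosh ?hdist_ge0 ?Cr.
move=> F FF FC.
have FV A : F A -> (@hvec R d @ F) (@hvec R d @` A).
  by apply: (@filterS _ F) => x Ax; exists x.
have [_ [[x Cx <-] clx]] := cV (@hvec R d @ F) _ (FV _ FC).
exists x; split => // A B FA /=; rewrite nbhsE => -[_ [[U oU <-] Ux] sub].
have [_ [[y Ay <-] Uy]] := clx _ _ (FV _ FA) (open_nbhs_nbhs (conj oU Ux)).
by exists y; split => //; exact: sub.
Qed.

Lemma compact_min C (f : hspace R d -> R) : C !=set0 -> compact C -> continuous f ->
  exists2 x, C x & forall y, C y -> f x <= f y.
Proof.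
move=> C0 cC cf.
have [|x /set_mem Cx xmin] := compact_EVT_min C0 cC (_ : {within C, continuous f}).
  exact: continuous_subspaceT.
by exists x => // y Cy; apply: xmin; exact: mem_set.
Qed.

Lemma compact_max C (f : hspace R d -> R) : C !=set0 -> compact C -> continuous f ->
  exists2 x, C x & forall y, C y -> f y <= f x.
Proof.
move=> C0 cC cf.
have [|x /set_mem Cx xmax] := compact_EVT_max C0 cC (_ : {within C, continuous f}).
  exact: continuous_subspaceT.
by exists x => // y Cy; apply: xmax; exact: mem_set.
Qed.

Lemma hvec_minkowski_continuous n : continuous (fun x : hspace R d => ⟨hvec x, n⟩).
Proof.
move=> x; apply: (@cvg_minkowski _ (nbhs x) _ (@hvec R d) (cst n)).
  exact: hvec_continuous.
exact: cvg_cst.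
Qed.

Lemma affine_continuous (c : R) u :
  continuous (fun x : hspace R d => c + ⟨hvec x, u⟩).
Proof.
move=> x; apply: (@cvgD _ _ _ (nbhs x) _ (cst c) (fun x => ⟨hvec x, u⟩)).
  exact: cvg_cst.
exact: hvec_minkowski_continuous.
Qed.

Lemma ratio_continuous u v : (forall x, ⟨hvec x, v⟩ != 0) ->
  continuous (fun x : hspace R d => ⟨hvec x, u⟩ / ⟨hvec x, v⟩).
Proof.
move=> v0 x.
apply: (@cvgM _ _ (nbhs x) _ (fun x => ⟨hvec x, u⟩) (fun x => ⟨hvec x, v⟩^-1)).
  exact: hvec_minkowski_continuous.
apply: (@cvgV _ _ (nbhs x) _ (fun x => ⟨hvec x, v⟩)) => //.
exact: hvec_minkowski_continuous.
Qed.

End Topology.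

(** * Supporting hyperplanes and width *)

Section Supports.
Variables (R : realType) (d : nat).
Implicit Types (a b x y : hspace R d) (u v n : 'rV[R]_d.+1).
Implicit Types (C : set (hspace R d)) (H J : hyperplane R d).

Lemma unitizeK v : ⟨v, v⟩ < 0 -> v = Num.sqrt (- ⟨v, v⟩) *: unitize v.
Proof.
by move=> vv; rewrite scalerA divff ?scale1r // lt0r_neq0 // sqrtr_gt0 oppr_gt0.
Qed.

Lemma unitizeZ_hvec (c : R) x : 0 < c -> unitize (c *: hvec x) = hvec x.
Proof.
move=> c0; rewrite /unitize !minkowskiE (hyperboloid_norm (hvecP x)).
have -> : - (c * (c * -1)) = c ^+ 2 by ring.
by rewrite sqrtr_sqr gtr0_norm // scalerA mulVf ?scale1r // lt0r_neq0.
Qed.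

Lemma conic_future (s t : R) a b : 0 <= s -> 0 < t ->
  let v := s *: hvec a + t *: hvec b in ⟨v, v⟩ < 0 /\ 0 < time v.
Proof.
move=> s0 t0 v; have ab := hyperboloid_leN1 (hvecP a) (hvecP b).
rewrite /v !minkowskiE (minkowskiC (hvec b)) !mxE.
rewrite (hyperboloid_norm (hvecP a)) (hyperboloid_norm (hvecP b)); split.
  have := mulr_ge0 s0 (ltW t0); have := mulr_gt0 t0 t0; have := mulr_ge0 s0 s0.
  by nra.
have a0 := hyperboloid_time (hvecP a); have b0 := hyperboloid_time (hvecP b).
by rewrite ltr_wpDl ?mulr_gt0 // mulr_ge0 // ltW.
Qed.

(** The crossing point is interior because it lies inside the cone spanned by [a]
    and a neighbourhood of [o] in [C]. *)
Lemma interior_crossing C n a o : hconvex C -> C a -> C^° o ->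
  ⟨hvec a, n⟩ < 0 -> 0 < ⟨hvec o, n⟩ -> exists2 z, C^° z & ⟨hvec z, n⟩ = 0.
Proof.
move=> Cconv Ca Co an on.
pose s := ⟨hvec o, n⟩; pose t := - ⟨hvec a, n⟩.
have t0 : 0 < t by rewrite oppr_gt0.
have [vv v0] := conic_future a o (ltW on) t0.
set v := _ *: _ + _ in vv v0.
pose z := point_of (unitize_hyperboloid vv v0).
set r := Num.sqrt (- ⟨v, v⟩).
have r0 : 0 < r by rewrite sqrtr_gt0 oppr_gt0.
have rz : r *: hvec z = v by rewrite [RHS](unitizeK vv).
have vn : ⟨v, n⟩ = 0 by rewrite /v minkowskiDl !minkowskiZl /t /s; ring.
exists z; last by rewrite hvec_point_of /unitize minkowskiZl vn mulr0.
apply/interior_near.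
(* Up to a factor, [r w - s a] is a point beyond [w] as seen from [a]; at [w = z] it
   is [o]. *)
have fz : r *: w - s *: hvec a @[w --> hvec z] --> t *: hvec o.
  have -> : t *: hvec o = r *: hvec z - s *: hvec a.
    by rewrite rz /v /s addrC addKr.
  exact: (@cvgB _ _ _ (nbhs (hvec z)) _ (fun w => r *: w) (cst (s *: hvec a)) _ _
    (@cvgZl_tmp _ _ _ (nbhs (hvec z)) _ r id _ cvg_id) (cvg_cst _)).
have [tt to0] := conic_future o o (lexx 0) t0.
rewrite scale0r add0r in tt to0.
apply: filterS (near_unitize_interior tt to0 (unitizeZ_hvec o t0) Co fz).
move=> w [y [Cy yE ww]] x xw.
apply: (hconvex_conic Cconv Ca Cy (s := s / r)
  (t := Num.sqrt (- ⟨r *: w - s *: hvec a, r *: w - s *: hvec a⟩) / r)).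
- by rewrite divr_ge0 // ltW.
- by rewrite divr_ge0 ?sqrtr_ge0 // ltW.
rewrite yE [Num.sqrt _ / r]mulrC -[_ *: unitize _]scalerA -unitizeK // xw.
by rewrite scalerBr !scalerA mulVf ?lt0r_neq0 // scale1r [s / r]mulrC addrC subrK.
Qed.

(** An interior point on the hyperplane could be moved a little in direction
    [- n], to the wrong side of it, without leaving [C]. *)
Lemma interior_side C n x : 0 < ⟨n, n⟩ ->
  (forall y, C y -> 0 <= ⟨hvec y, n⟩) -> C^° x -> 0 < ⟨hvec x, n⟩.
Proof.
move=> nn side Cx; rewrite lt_neqAle side ?andbT; last exact: interior_subset Cx.
apply/negP => /eqP xn.
have fx : hvec x - t *: n @[t --> (0 : R)^'+] --> hvec x.
  apply: cvg_at_right_filter.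
  have : hvec x - t *: n @[t --> (0 : R)] --> hvec x - 0 *: n.
    exact: (@cvgB _ _ _ (nbhs (0 : R)) _ (cst (hvec x)) (fun t => t *: n) _ _
      (cvg_cst _) (@cvgZr_tmp _ _ _ (nbhs (0 : R)) _ id _ n cvg_id)).
  by rewrite scale0r subr0.
have near_x : \forall t \near (0 : R)^'+, exists y,
    [/\ C y, hvec y = unitize (hvec x - t *: n) &
        ⟨hvec x - t *: n, hvec x - t *: n⟩ < 0].
  exact: (near_unitize_interior (hyperboloid_timelike (hvecP x))
    (hyperboloid_time (hvecP x)) (unitize_hvec x) Cx fx).
have [t [[y [Cy yE yy]] t0]] := filter_ex (filterI near_x (nbhs_right_gt (0 : R))).
have := side y Cy; rewrite yE minkowskiZl.
rewrite pmulr_rge0 ?invr_gt0 ?sqrtr_gt0 ?oppr_gt0 //.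
rewrite minkowskiDl minkowskiNl minkowskiZl -xn sub0r oppr_ge0.
by rewrite leNgt mulr_gt0.
Qed.

(** A supporting hyperplane misses the interior, hence by [interior_crossing] it
    does not separate an interior point from any other point of [C]. *)
Lemma supports_unit_normal C H : convex_body C -> supports H C ->
  exists2 n, unit_normal H n & forall x, C x -> 0 <= ⟨hvec x, n⟩.
Proof.
move=> [_ _ Cconv [ o Co]] [_ HC].
have Hno n z : unit_normal H n -> C^° z -> ⟨hvec z, n⟩ != 0.
  move=> Hn Cz; apply/eqP => /(unit_normal_hpoints _ Hn) Hz.
  by have : (hpoints H `&` C^°) z by []; rewrite HC.
suff [n Hn on] : exists2 n, unit_normal H n & 0 < ⟨hvec o, n⟩.
  exists n => // a Ca; rewrite leNgt; apply/negP => an.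
  have [z Cz zn] := interior_crossing Cconv Ca Co an on.
  by have := Hno n z Hn Cz; rewrite zn eqxx.
have Hn := unit_normal_exists H; move: ((_ : R) *: _) Hn => n Hn.
have := Hno n o Hn Co; rewrite neq_lt => /orP[on| on]; last by exists n.
by exists (- n); [exact: unit_normalN|rewrite minkowskiNr oppr_gt0].
Qed.

Lemma supports_side C H n : unit_normal H n ->
  (forall x, C x -> 0 <= ⟨hvec x, n⟩) -> (exists2 x, C x & ⟨hvec x, n⟩ = 0) ->
  supports H C.
Proof.
move=> Hn side [x Cx xn]; split.
  by exists x; split => //; apply/(unit_normal_hpoints _ Hn).
apply/seteqP; split => // y [/(unit_normal_hpoints _ Hn) yn Cy].
have n0 : 0 < ⟨n, n⟩ by rewrite Hn.1.
by have := interior_side n0 side Cy; rewrite yn ltxx.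
Qed.

(** The farthest ultraparallel supporting hyperplane is the one through [j]
    perpendicular to the perpendicular from [j] to [H]. *)
Lemma is_width_most_distant C H j w : convex_body C -> supports H C ->
  most_distant C H j -> is_width C H w <-> w = dist [set j] (hpoints H).
Proof.
move=> Cbody HC [Cj jmax].
have [n Hn side] := supports_unit_normal Cbody HC; have nn := Hn.1.
have jn x : C x -> ⟨hvec x, n⟩ <= ⟨hvec j, n⟩.
  move=> Cx; have := jmax x Cx; rewrite (ler_dist_hpoints _ _ Hn).
  by rewrite !ger0_norm ?side.
have jn0 : 0 < ⟨hvec j, n⟩.
  have [_ _ _ [ o Co]] := Cbody.
  apply: lt_le_trans (jn o (interior_subset Co)).
  by apply: interior_side Co; rewrite ?nn.
pose p := point_of (foot_hyperboloid nn (hvecP j)).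
have pH : hpoints H p := unit_normal_foot j nn Hn.
pose m := top_normal n (hvec j).
have mm : ⟨m, m⟩ = 1 := top_normal_unit j nn.
have m_spacelike : 0 < ⟨m, m⟩ by rewrite mm.
pose J := Hyperplane m_spacelike.
have Jm : unit_normal J m by split => //; exists 1; rewrite ?oner_eq0 // scale1r.
have jJ : hpoints J j by exact: top_normal_self.
have far a b : hpoints H a -> hpoints J b ->
    arcosh (perp_cosh n (hvec j)) <= hdist a b.
  move=> /(unit_normal_hpoints _ Hn) an /(unit_normal_hpoints _ Jm) bm.
  rewrite ler_arcosh ?hvec_ge1 ?perp_cosh_ge1 //.
  apply: (le_trans _ (perp_cosh_le nn (hvecP b) (hvecP a) an)).
  rewrite ler_sqrt ?addr_ge0 ?sqr_ge0 // lerD2l.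
  have jb := top_normal_far nn (ltW jn0) bm.
  by rewrite ler_sqr // nnegrE ?(le_trans (ltW jn0)) // ltW.
have dHJ' J' : supports J' C ->
    dist (hpoints H) (hpoints J') <= dist [set j] (hpoints H).
  move=> [[x [J'x Cx]] _].
  apply: le_trans (jmax x Cx); rewrite (dist_hpoints x Hn) -(hdist_foot x nn).
  by apply: dist_le_hdist => //; exact: unit_normal_foot.
have Jsupp : supports J C.
  apply: (supports_side (unit_normalN Jm)).
    move=> x Cx; rewrite minkowskiNr oppr_ge0.
    by apply: top_normal_le0; rewrite ?side ?jn.
  by exists j => //; rewrite minkowskiNr top_normal_self // oppr0.
have dHJ : dist (hpoints H) (hpoints J) = dist [set j] (hpoints H).
  apply/eqP; rewrite eq_le dHJ' //= (dist_hpoints j Hn).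
  by apply: le_dist; [exists p|exists j|].
have HJ : ultraparallel H J.
  split; apply/seteqP; split => //.
    move=> x [Hx Jx]; have := top_normal_far nn (ltW jn0) Jx.
    by move/(unit_normal_hpoints _ Hn): Hx => ->; rewrite leNgt jn0.
  move=> l [[[ll l0] lH] [_ lJ]]; have ln : ⟨l, n⟩ = 0.
    case: Hn => _ [c c0 HE]; move/eqP: lH; rewrite HE minkowskiZr mulf_eq0.
    by rewrite (negbTE c0) => /eqP.
  have lp : ⟨hvec p, l⟩ < 0.
    by apply: (hyperboloid_causal_lt0 (hvecP p)); rewrite ?ll ?l0 ?ltr01.
  move: lJ lp; rewrite /= /m /top_normal hvec_point_of (minkowskiC _ l).
  move: (foot _ _) => f; rewrite minkowskiDr !minkowskiZr ln mulr0 addr0 => /eqP.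
  by rewrite mulf_eq0 gt_eqF //= => /eqP ->; rewrite ltxx.
split=> [[J' [[HJ' J'C] J'max] <-]|->].
  apply/eqP; rewrite eq_le dHJ' //= -dHJ.
  by apply: J'max.
by exists J => //; split => // J' [_ J'C]; rewrite dHJ dHJ'.
Qed.

End Supports.

(** * Tilting a supporting hyperplane *)

Section Tilt.
Variables (R : realType) (d : nat).
Implicit Types (a b x y p q j : hspace R d) (u v n : 'rV[R]_d.+1).
Implicit Types (C K : set (hspace R d)) (H J : hyperplane R d).

(** Convexity of the cone over [K]; unlike convexity in terms of geodesics, it is
    evidently inherited by the intersection of [K] with a hyperplane. *)
Definition conic_convex K := forall a b x (s t : R), K a -> K b ->
  0 <= s -> 0 <= t -> hvec x = s *: hvec a + t *: hvec b -> K x.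

Lemma conic_convex_face C n : hconvex C ->
  conic_convex [set x | C x /\ ⟨hvec x, n⟩ = 0].
Proof.
move=> Cconv a b x s t [Ca an] [Cb bn] s0 t0 xE; split.
  exact: hconvex_conic Ca Cb s0 t0 xE.
by rewrite xE minkowskiDl !minkowskiZl an bn !mulr0 addr0.
Qed.

(** The squared inequality [cosh |pq| <= cosh |pz|] for the central projection [z]
    of [(1 - t) q + t x], with the denominator cleared and divided by [t]. *)
Lemma conic_unitize_le K p q x (t : R) : conic_convex K -> K q -> K x ->
  (forall y, K y -> - ⟨hvec p, hvec q⟩ <= - ⟨hvec p, hvec y⟩) ->
  0 < t -> t < 1 ->
  0 <= 2 * - ⟨hvec p, hvec q⟩ * (1 - t) *
         (- ⟨hvec p, hvec x⟩ - ⟨hvec p, hvec q⟩ * ⟨hvec q, hvec x⟩) +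
       t * (⟨hvec p, hvec x⟩ ^+ 2 - ⟨hvec p, hvec q⟩ ^+ 2).
Proof.
move=> Kconv Kq Kx qmin t0 t1.
have t1' : 0 <= 1 - t by lra.
have [zz z0] := conic_future q x t1' t0.
set z := _ *: _ + _ in zz z0.
have r0 : 0 < Num.sqrt (- ⟨z, z⟩) by rewrite sqrtr_gt0 oppr_gt0.
have r2 : Num.sqrt (- ⟨z, z⟩) ^+ 2 = - ⟨z, z⟩ by rewrite sqr_sqrtr // oppr_ge0 ltW.
have Kz : K (point_of (unitize_hyperboloid zz z0)).
  apply: (Kconv q x _ ((Num.sqrt (- ⟨z, z⟩))^-1 * (1 - t))
    ((Num.sqrt (- ⟨z, z⟩))^-1 * t)) => //.
  - by rewrite mulr_ge0 // invr_ge0 ltW.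
  - by rewrite mulr_ge0 ?invr_ge0 // ltW.
  by rewrite hvec_point_of /unitize /z scalerDr !scalerA.
have := qmin _ Kz; rewrite hvec_point_of minkowskiZr -mulrN.
rewrite mulrC ler_pdivlMr //.
have pq := hvec_ge1 p q.
have zE : - ⟨z, z⟩ = (1 - t) ^+ 2 + t ^+ 2 - 2 * t * (1 - t) * ⟨hvec q, hvec x⟩.
  rewrite /z !minkowskiE (minkowskiC (hvec x)) (hyperboloid_norm (hvecP q)).
  by rewrite (hyperboloid_norm (hvecP x)); ring.
have pz : - ⟨hvec p, z⟩ = - ((1 - t) * ⟨hvec p, hvec q⟩ + t * ⟨hvec p, hvec x⟩).
  by rewrite /z !minkowskiE.
rewrite pz; rewrite zE in r0 r2 *; move: r0 r2.
move: (Num.sqrt _) => r r0 r2 le_r.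
have : (- ⟨hvec p, hvec q⟩ * r) ^+ 2 <=
    ((1 - t) * ⟨hvec p, hvec q⟩ + t * ⟨hvec p, hvec x⟩) ^+ 2.
  rewrite -[leRHS]sqrrN ler_sqr // nnegrE; first by rewrite mulr_ge0; lra.
  by apply: le_trans le_r; rewrite mulr_ge0; lra.
rewrite exprMn r2 => h; rewrite -(pmulr_rge0 _ t0); lra.
Qed.

(** The angle at the point [q] of a convex set that is nearest to [p], towards any
    point [x] of the set, is not acute; by the hyperbolic law of cosines
    this means [cosh |px| >= cosh |pq| * cosh |qx|]. *)
Lemma nearest_obtuse K p q x : conic_convex K -> K q -> K x ->
  (forall y, K y -> - ⟨hvec p, hvec q⟩ <= - ⟨hvec p, hvec y⟩) ->
  ⟨hvec p, hvec q⟩ * ⟨hvec q, hvec x⟩ <= - ⟨hvec p, hvec x⟩.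
Proof.
move=> Kconv Kq Kx qmin; rewrite leNgt; apply/negP => lt_y.
have := conic_unitize_le Kconv Kq Kx qmin.
have := qmin x Kx; have := hvec_ge1 p q.
move: lt_y; move: ⟨hvec p, hvec q⟩ ⟨hvec p, hvec x⟩ ⟨hvec q, hvec x⟩ => c y g lt_y c1 cy.
(* At [t = 0] the quantity to be refuted is [2 c e < 0]; [t] is so small that the
   term [t M] does not compensate for this. *)
pose e := c * g + y; pose M := y ^+ 2 - c ^+ 2.
have e0 : 0 < e by rewrite /e; lra.
have M0 : 0 <= M by rewrite /M; nra.
have ce : 0 < - c * e by rewrite mulr_gt0 //; lra.
have D0 : 0 < M + 2 * (- c * e) by lra.
pose t := (- c * e) / (M + 2 * (- c * e)).
have tD : t * (M + 2 * (- c * e)) = - c * e.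
  by rewrite /t divfK // lt0r_neq0.
have t0 : 0 < t by rewrite divr_gt0.
have t1 : t < 1 by rewrite ltr_pdivrMr //; lra.
move=> /(_ t t0 t1); rewrite -/M.
have -> : 2 * - c * (1 - t) * (- y - c * g) + t * M =
  t * (M + 2 * (- c * e)) - 2 * (- c * e) by rewrite /e; ring.
by rewrite tD; lra.
Qed.

(** Where [f] is small, [g] is positive by compactness, that is, [max f g] is
    bounded below by a positive constant; elsewhere a small multiple of [g]
    cannot offset [f]. *)
Lemma small_perturbation_gt0 K (f g : hspace R d -> R) : K !=set0 -> compact K ->
  continuous f -> continuous g -> (forall x, K x -> 0 <= f x) ->
  (forall x, K x -> f x = 0 -> 0 < g x) ->
  exists2 e : R, 0 < e &
    forall e' x, 0 < e' -> e' <= e -> K x -> 0 < f x + e' * g x.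
Proof.
move=> K0 cK cf cg f0 fg.
have cfg : continuous (f \max g) by exact: max_fun_continuous.
have [x1 Kx1 hmin] := compact_min K0 cK cfg.
have [x2 Kx2 gmin] := compact_min K0 cK cg.
pose c := (f \max g) x1; pose M := `|g x2| + 1.
have c0 : 0 < c.
  rewrite /c /= lt_max; have := f0 x1 Kx1; rewrite le_eqVlt => /orP[/eqP fx|->//].
  by rewrite [0 < g x1]fg ?orbT.
have M0 : 0 < M by rewrite ltr_wpDl.
have gM x : K x -> - M < g x.
  move=> Kx; apply: lt_le_trans (gmin x Kx).
  have := ler_norm (- g x2); rewrite normrN /M; lra.
exists (c / M); first by rewrite divr_gt0.
move=> e x e0 eM Kx; have := hmin x Kx; rewrite -/c /= le_max => /orP[cfx|cgx].
  have : e * M <= c by rewrite -ler_pdivlMr.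
  by have := gM x Kx; nra.
have : 0 < e * g x by rewrite mulr_gt0 //; lra.
by have := f0 x Kx; lra.
Qed.

(** Tilt the hyperplane [n] about the perpendicular bisector of [p] and its
    nearest point [q] of the face, then push it back against [C]; the vector
    [k *: hvec p] does the latter, and stays small enough for the new normal to be
    at least as long as [n]. *)
Lemma tilt C n j p : convex_body C -> ⟨n, n⟩ = 1 ->
  (forall x, C x -> 0 <= ⟨hvec x, n⟩) -> (exists2 x, C x & ⟨hvec x, n⟩ = 0) ->
  C j -> (forall x, C x -> x <> j -> ⟨hvec x, n⟩ < ⟨hvec j, n⟩) ->
  hvec p = foot n (hvec j) -> ~ C p ->
  exists m, [/\ 1 <= ⟨m, m⟩, forall x, C x -> 0 <= ⟨hvec x, m⟩ < ⟨hvec j, n⟩ &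
                exists2 x, C x & ⟨hvec x, m⟩ = 0].
Proof.
move=> [clC Cbd Cconv _] nn side [x0 Cx0 x0n] Cj jmax pE nCp.
have cC := hbounded_closed_compact clC Cbd.
have pn : ⟨hvec p, n⟩ = 0 by rewrite pE foot_orth.
pose F := [set x | C x /\ ⟨hvec x, n⟩ = 0].
have Fconv : conic_convex F := conic_convex_face (n := n) Cconv.
have cF : compact F.
  have -> : F = C `&` (fun x => ⟨hvec x, n⟩) @^-1` [set r | r = 0] by [].
  apply: hbounded_closed_compact; last first.
    by case: Cbd => r Cr; exists r => a b [Ca _] [Cb _]; exact: Cr.
  apply: closedI => //; apply: preimage_closed; last exact: closed_eq.
  by move=> x _; exact: hvec_minkowski_continuous.
have F0 : F !=set0 by exists x0.
have pcont : continuous (fun x : hspace R d => ⟨hvec x, - hvec p⟩).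
  exact: hvec_minkowski_continuous.
have [q Fq qmin] := compact_min F0 cF pcont.
have [Cq qn] := Fq.
have {}qmin y : F y -> - ⟨hvec p, hvec q⟩ <= - ⟨hvec p, hvec y⟩.
  by move=> Fy; rewrite !(minkowskiC (hvec p)) -!minkowskiNr; exact: qmin.
pose v := hvec q - hvec p.
have pp := hyperboloid_norm (hvecP p); have qq := hyperboloid_norm (hvecP q).
have pq : ⟨hvec p, hvec q⟩ < -1.
  rewrite lt_neqAle hyperboloid_leN1 ?andbT; try exact: hvecP.
  apply/eqP => /(hyperboloid_eq (hvecP p) (hvecP q)) /hvec_inj pq.
  by apply: nCp; rewrite pq.
have Fv x : F x -> 0 < ⟨hvec x, v⟩.
  move=> Fx; have := nearest_obtuse Fconv Fq Fx qmin.
  have := hyperboloid_leN1 (hvecP q) (hvecP x).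
  rewrite /v minkowskiDr minkowskiNr !(minkowskiC (hvec x)); nra.
have jv : ⟨hvec j, v⟩ < 0.
  rewrite (foot_decomp n (hvec j)) -pE minkowskiDl !minkowskiZl.
  rewrite /v !(minkowskiDr, minkowskiNr) !(minkowskiC n) pn qn pp.
  by have := perp_cosh_gt0 n (hvec j); nra.
have ncont : continuous (fun x : hspace R d => ⟨hvec x, n⟩).
  exact: hvec_minkowski_continuous.
have vcont : continuous (fun x : hspace R d => ⟨hvec x, v⟩).
  exact: hvec_minkowski_continuous.
have C0 : C !=set0 by exists j.
have [e1 e10 low] : exists2 e : R, 0 < e & forall e' x, 0 < e' -> e' <= e ->
    C x -> 0 < ⟨hvec x, n⟩ + e' * ⟨hvec x, v⟩.
  by apply: small_perturbation_gt0 => // x Cx xn; apply: Fv.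
have [e2 e20 up] : exists2 e : R, 0 < e & forall e' x, 0 < e' -> e' <= e ->
    C x -> 0 < (⟨hvec j, n⟩ + ⟨hvec x, - n⟩) + e' * ⟨hvec x, - v⟩.
  apply: small_perturbation_gt0 => //; [exact: affine_continuous|
    exact: hvec_minkowski_continuous| |].
  - move=> x Cx; rewrite minkowskiNr; have [->|/eqP xj] := eqVneq x j.
      by rewrite subrr.
    by rewrite subr_ge0 ltW // jmax.
  move=> x Cx; rewrite !minkowskiNr; have [-> _|/eqP xj] := eqVneq x j.
    by rewrite oppr_gt0.
  by have := jmax x Cx xj; lra.
pose e := Num.min e1 e2.
have e0 : 0 < e by rewrite lt_min e10.
have den x : 0 < ⟨hvec x, - (e *: hvec p)⟩.
  rewrite minkowskiNr minkowskiZr -mulrN mulr_gt0 //.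
  by rewrite (lt_le_trans ltr01) // hvec_ge1.
(* [r x] is the amount of pushing for which the tilted hyperplane meets [x]; the
   first contact with [C] is where it is minimal. *)
pose r x := ⟨hvec x, n + e *: v⟩ / ⟨hvec x, - (e *: hvec p)⟩.
have rcont : continuous r.
  by apply: ratio_continuous => x; rewrite lt0r_neq0.
have [y Cy ymin] := compact_min C0 cC rcont.
pose k := r y.
have k0 : 0 <= k.
  rewrite divr_ge0 // ltW // minkowskiDr minkowskiZr low //.
  by rewrite /e ge_min lexx.
have kq : k * - ⟨hvec p, hvec q⟩ <= - ⟨hvec p, hvec q⟩ - 1.
  have := ymin q Cq; rewrite -/k /r ler_pdivlMr //.
  rewrite !(minkowskiNr, minkowskiDr, minkowskiZr) qq (minkowskiC (hvec q)) => h.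
  by rewrite -(ler_pM2l e0); lra.
pose m := n + e *: (v + k *: hvec p).
have mE x : ⟨hvec x, m⟩ = ⟨hvec x, n + e *: v⟩ - k * ⟨hvec x, - (e *: hvec p)⟩.
  by rewrite /m !(minkowskiDr, minkowskiZr, minkowskiNr); ring.
exists m; split.
- have -> : m = n + e *: (hvec q - (1 - k) *: hvec p).
    by rewrite /m /v scalerBl scale1r opprB addrA addrAC -addrA.
  rewrite !minkowskiE nn !(minkowskiC n) pn qn pp qq (minkowskiC (hvec q)).
  (* With [c = cosh |pq|] and [s = 1 - k], the added vector [q - s p] has square
     [2 s c - 1 - s ^ 2], where [s c >= 1 >= s]. *)
  have rc : 1 <= (1 - k) * - ⟨hvec p, hvec q⟩ by lra.
  have r0 : 0 <= 1 - k by nra.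
  have r2 : (1 - k) ^+ 2 <= 1 by nra.
  have gap : 0 <= e ^+ 2 * (2 * ((1 - k) * - ⟨hvec p, hvec q⟩) - 1 - (1 - k) ^+ 2).
    by rewrite mulr_ge0 ?sqr_ge0 //; lra.
  by lra.
- move=> x Cx; rewrite mE; apply/andP; split.
    by rewrite subr_ge0 -ler_pdivlMr //; exact: ymin.
  have := up e x e0; rewrite {1}/e ge_min lexx orbT => /(_ isT Cx).
  have := mulr_ge0 k0 (ltW (den x)).
  by rewrite !(minkowskiDr, minkowskiZr, minkowskiNr); lra.
by exists y => //; rewrite mE /k /r divfK ?subrr // lt0r_neq0.
Qed.

End Tilt.

(** * Orthogonal projection *)

Section Projection.
Variables (R : realType) (d : nat).
Implicit Types (H : hyperplane R d) (p q x : hspace R d).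

Lemma minkowski_direction p x y :
  ⟨direction p x, direction p y⟩ =
  ⟨hvec x, hvec y⟩ + ⟨hvec x, hvec p⟩ * ⟨hvec p, hvec y⟩.
Proof.
rewrite /direction !minkowskiE (hyperboloid_norm (hvecP p)).
by rewrite (minkowskiC (hvec y) (hvec p)); ring.
Qed.

(** If [p] also has the orthogonality property, testing it against the foot [f]
    gives [⟨f, p⟩ ^ 2 = 1], and two points with this property coincide. *)
Lemma is_projection_foot H n p x : unit_normal H n ->
  is_projection H x p <-> hvec p = foot n (hvec x).
Proof.
move=> Hn; have nn := Hn.1; set f := point_of (foot_hyperboloid nn (hvecP x)).
have fE : hvec f = foot n (hvec x) by [].
have fH : hpoints H f := unit_normal_foot x nn Hn.
have xq q : hpoints H q ->
    ⟨hvec x, hvec q⟩ = perp_cosh n (hvec x) * ⟨hvec f, hvec q⟩.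
  move=> /(unit_normal_hpoints _ Hn) qn.
  by rewrite {1}(foot_decomp n (hvec x)) -fE minkowskiDl !minkowskiZl
    (minkowskiC n) qn mulr0 addr0.
have ff := hyperboloid_norm (hvecP f); have c0 := perp_cosh_gt0 n (hvec x).
rewrite -fE; split=> [[pH orth]|/hvec_inj ->].
  apply/esym/hyperboloid_eq; try exact: hvecP.
  have := orth f fH; rewrite minkowski_direction !xq // ff (minkowskiC (hvec p)).
  have := hyperboloid_lt0 (hvecP f) (hvecP p).
  move: ⟨hvec f, hvec p⟩ => g g0 E.
  have : g ^+ 2 = 1 by apply: (@mulfI _ (perp_cosh n (hvec x))); [exact: lt0r_neq0|lra].
  by move/eqP; rewrite sqrf_eq1 => /orP[] /eqP g1; lra.
split=> // q qH; rewrite minkowski_direction !xq // ff.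
by rewrite mulrN1 mulNr subrr.
Qed.

End Projection.

(** * The projection of the farthest point *)

Theorem theorem2 (R : realType) (d : nat) (C : set (hspace R d))
    (H : hyperplane R d) (j : hspace R d)
    (C_body : convex_body C)
    (H_supports : supports H C)
    (H_width : is_width C H (thickness C))
    (j_unique : unique (most_distant C H) j) :
  exists2 p, unique (is_projection H j) p & (hpoints H `&` C) p.
Proof.
have [j_far j_only] := j_unique; have [Cj jmax] := j_far.
have [n Hn side] := supports_unit_normal C_body H_supports; have nn := Hn.1.
have wE := (is_width_most_distant (thickness C) C_body H_supports j_far).1 H_width.
pose p := point_of (foot_hyperboloid nn (hvecP j)).
have pE : hvec p = foot n (hvec j) by [].
have pH : hpoints H p := unit_normal_foot j nn Hn.
exists p.
  split; first exact/(is_projection_foot _ _ Hn).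
  by move=> q /(is_projection_foot _ _ Hn) qE; apply: hvec_inj; rewrite qE.
split=> //; apply: contrapT => nCp.
have touch : exists2 x, C x & ⟨hvec x, n⟩ = 0.
  by case: H_supports => -[x [/(unit_normal_hpoints _ Hn) Hx Cx]] _; exists x.
have jstrict x : C x -> x <> j -> ⟨hvec x, n⟩ < ⟨hvec j, n⟩.
  move=> Cx xj; rewrite ltNge; apply/negP => jx; apply: xj; apply/esym/j_only.
  split=> // y Cy; apply: le_trans (jmax y Cy) _.
  by rewrite (ler_dist_hpoints _ _ Hn) !ger0_norm // side.
have [m [mm mC [z Cz zm]]] := tilt C_body nn side touch Cj jstrict pE nCp.
have m0 : 0 < ⟨m, m⟩ by lra.
pose H' := Hyperplane m0.
pose s := Num.sqrt ⟨m, m⟩.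
have s1 : 1 <= s by rewrite -(sqrtr1 R) ler_wsqrtr.
have s0 : 0 < s by lra.
pose N := s^-1 *: m.
have H'N : unit_normal H' N := unit_normal_exists H'.
have NC x : C x -> 0 <= ⟨hvec x, N⟩ < ⟨hvec j, n⟩.
  move=> Cx; have /andP[x0 xj] := mC x Cx.
  rewrite minkowskiZr mulr_ge0 ?invr_ge0 ?(ltW s0) //=.
  apply: le_lt_trans xj; rewrite ler_piMl // invf_le1 //.
have zN : ⟨hvec z, N⟩ = 0 by rewrite minkowskiZr zm mulr0.
have H'C : supports H' C.
  apply: (supports_side H'N) => [x /NC /andP[] //|]; by exists z.
have cC : compact C by case: C_body => *; exact: hbounded_closed_compact.
have [|j' Cj' j'max] := compact_max _ cC (@hvec_minkowski_continuous R d N).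
  by exists j.
have j'_far : most_distant C H' j'.
  split=> // x Cx; rewrite (ler_dist_hpoints _ _ H'N).
  by rewrite !ger0_norm ?j'max //; [case/andP: (NC _ Cj')|case/andP: (NC _ Cx)].
have le_w : thickness C <= dist [set j'] (hpoints H').
  apply: ge_inf.
    by exists 0 => _ [K _ [J _ <-]]; exact: dist_ge0.
  by exists H' => //; apply/(is_width_most_distant _ C_body H'C j'_far).
move: le_w; rewrite wE (dist_hpoints _ Hn) (dist_hpoints _ H'N).
have /andP[j'0 j'j] := NC _ Cj'.
rewrite leNgt ltr_arcosh ?perp_cosh_ge1 // ltr_sqrt.
  by rewrite ltrD2l ltr_sqr ?j'j // nnegrE; lra.
by rewrite ltr_pwDl // sqr_ge0.
Qed.
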